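(* Let $H$ be a real Hilbert space with inner product $(\cdot,\cdot)$ and norm $\|\cdot\|$, and let $F:H\to H$ be a (possibly nonlinear) Fréchet differentiable mapping such that $$\lim_{\|u\|\to\infty}\frac{(u,F(u))}{\|u\|}=\infty$$ and $$(F(u)-F(v),\,u-v)\geq 0\quad\text{for all } u,v\in H.$$ Then for every $h\in H$ there exists $u\in H$ such that $F(u)=h$.
   Context: The limit condition means: for every $M>0$ there is $R>0$ such that $(u,F(u))/\|u\|\geq M$ for all $u\in H$ with $\|u\|\geq R$. Fréchet differentiable means Fréchet differentiable at every point of $H$. *)

(* Defs.v *)
From HB Require Import structures.
From mathcomp Require Export all_boot all_order all_algebra.
From mathcomp Require Export all_classical all_reals all_analysis.
Export Order.TTheory GRing.Theory Num.Theory.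
Export numFieldNormedType.Exports.

#[export] Set Implicit Arguments.
#[export] Unset Strict Implicit.
#[export] Unset Printing Implicit Defensive.

Local Open Scope ring_scope.

(* A real Hilbert space is rendered as a complete normed module H over the
   reals R, together with a symmetric positive definite bilinear form
   dot : {dot H for idfun} such that [induces_norm dot] holds. Completeness and
   [differentiable] (Frechet: the differential is required to be continuous)
   are then relative to the norm coming from the inner product. *)
Definition induces_norm (R : realType) (H : completeNormedModType R)
    (dot : {dot H for (@idfun R)}) : Prop :=
  forall u : H, `|u| = Num.sqrt (dot u u).

(* The limit of (u, F u) / ||u|| as ||u|| tends to infinity is infinite. *)
Definition coercive (R : realType) (H : completeNormedModType R)
    (dot : {dot H for (@idfun R)}) (F : H -> H) : Prop :=
  forall M : R, 0 < M -> exists r : R, 0 < r /\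
    forall u : H, r <= `|u| -> M <= dot u (F u) / `|u|.

(* Main.v *)
(* For each e > 0 the map F + e id is strongly monotone, and it attains h:
   Ekeland's principle applied to u |-> |F u + e u - h| yields a point from
   which this distance cannot decrease fast, while strong monotonicity makes it
   decrease fast in the direction h - (F u + e u) unless it vanishes. Let x_n
   solve F x_n + e_n x_n = h with e_n = 1/(n+1). Coercivity bounds |x_n|, and
   monotonicity gives |x_m - x_n|^2 <= |x_m|^2 - |x_n|^2 for n <= m. So |x_n|^2
   is nondecreasing and bounded, x_n is Cauchy in norm, and its limit u satisfies
   F u = h by continuity; no weak compactness is needed. *)
Require Import Defs.
From mathcomp Require Import ring lra.
Local Open Scope classical_set_scope.
Local Open Scope ring_scope.

(** A Cauchy argument: the increments of [a] past some rank are below [e ^+ p.+1], and a positive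
    power is strictly monotone. It serves with [p = 0] for Ekeland's iteration and with [p = 1] for
    squared norms. *)
Lemma cvgn_dist_expr (R : realType) (X : completeNormedModType R)
    (u : nat -> X) (a : R^nat) (p : nat) :
  cvgn a ->
  (forall n m, (n <= m)%N -> `|u m - u n| ^+ p.+1 <= `|a m - a n|) ->
  cvgn u.
Proof.
move=> /cvg_ex[l al] ua; apply: cauchy_cvg; apply: cauchy_exP => e e0.
have e1 : 0 < e ^+ p.+1 / 2 by rewrite divr_gt0 ?exprn_gt0.
have /cvgrPdist_lt/(_ _ e1)[N _ aN] := al.
exists (u N), N => // m /= Nm; rewrite -ball_normE /ball_ /= distrC.
rewrite -(ltr_pXn2r (n := p.+1)) ?nnegrE ?(ltW e0)//.
apply: le_lt_trans (ua _ _ Nm) _.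
have /= lN := aN N (leqnn N); have /= := aN _ Nm; rewrite distrC => lm.
have -> : a m - a N = (a m - l) + (l - a N) by ring.
rewrite (le_lt_trans (ler_normD _ _))//; lra.
Qed.

Lemma near_inf_point (R : realType) (T : Type) (phi : T -> R) (S : set T) (u : T) :
  (forall v, 0 <= phi v) -> S u ->
  exists2 v, S v & forall w, S w -> phi v *+ 2 <= phi u + phi w.
Proof.
move=> phi0 Su.
have hinf : has_inf (phi @` S).
  by split; [exists (phi u), u|exists 0 => _ [v _ <-]].
have leinf w : S w -> inf (phi @` S) <= phi w.
  by move=> Sw; apply: ge_inf; [case: hinf|exists w].
(* If [phi u] is the infimum, [u] itself works; otherwise some value lies below the midpoint of
   [phi u] and the infimum. *)
have := leinf _ Su; rewrite le_eqVlt => /predU1P[iu|iu].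
  by exists u => // w /leinf; rewrite iu mulr2n lerD2l.
have d0 : 0 < (phi u - inf (phi @` S)) / 2 by lra.
have [_ [v Sv <-] vlt] := inf_adherent d0 hinf.
by exists v => // w /leinf; lra.
Qed.

(** The relation [S] is a preorder. Near-minimizing repeatedly within [S] gives a chain whose steps
    are controlled by the decrease of [phi]; its limit is the required point. *)
Lemma ekeland (R : realType) (X : completeNormedModType R) (phi : X -> R)
    (d : R) :
  0 < d -> (forall v, 0 <= phi v) -> continuous phi ->
  exists u, forall v, phi v + d * `|v - u| <= phi u -> v = u.
Proof.
move=> d0 phi0 phic.
pose S u := [set v | phi v + d * `|v - u| <= phi u].
have Sxx u : S u u by rewrite /S /= subrr normr0 mulr0 addr0.
have Strans u v w : S u v -> S v w -> S u w.
  rewrite /S /= => uv vw.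
  have : d * `|w - u| <= d * (`|w - v| + `|v - u|).
    by rewrite ler_pM2l// ler_distD.
  lra.
have /choice[f fP] : forall u, exists v, S u v /\
    forall w, S u w -> phi v *+ 2 <= phi u + phi w.
  by move=> u; have [v] := near_inf_point phi0 (Sxx u); exists v.
(* x n.+1 at least halves the gap between phi (x n) and inf phi over S (x n) *)
pose x n := iter n f 0.
have xS n m : (n <= m)%N -> S (x n) (x m).
  move=> /subnK <-; elim: (m - n)%N => [|k IH] //.
  by apply: Strans IH _; rewrite addSn; exact: (fP _).1.
have px : {homo (phi \o x) : n m / (n <= m)%N >-> m <= n}.
  move=> n m /xS; rewrite /S /=; apply: le_trans.
  by rewrite lerDl mulr_ge0// ltW.
have cpx : cvgn (phi \o x).
  by apply: nonincreasing_is_cvgn => //; exists 0 => _ [n _ <-] /=.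
have /cvg_ex[/= u xu] : cvgn x.
  apply: (@cvgn_dist_expr R X x (fun n => d^-1 * phi (x n)) 0%N).
    exact: is_cvgMr.
  move=> n m nm; rewrite expr1 -mulrBr normrM gtr0_norm ?invr_gt0//.
  rewrite ler_pdivlMl// (distrC (phi _)) ger0_norm ?subr_ge0; last exact: px.
  by have := xS _ _ nm; rewrite /S /=; lra.
have pxu : (phi \o x) n @[n --> \oo] --> phi u.
  by apply: continuous_cvg => //; exact: phic.
have Su n : S (x n) u.
  rewrite /S /=.
  have c : phi (x m) + d * `|x m - x n| @[m --> \oo] -->
      phi u + d * `|u - x n|.
    apply: cvgD => //; apply: cvgMr; apply: cvg_norm; apply: cvgB => //.
    exact: cvg_cst.
  rewrite -(cvg_lim _ c)//; apply: limr_le; first by apply/cvg_ex; exists (phi u + d * `|u - x n|).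
  by near=> m; apply: xS; near: m; exact: nbhs_infty_ge.
exists u => v uv.
(* By transitivity [v] lies in every [S (x n)], so the choice of [x n.+1] bounds [phi v] below by a
   sequence tending to [phi u]. *)
have le_uv : phi u <= phi v.
  have c : phi (x n.+1) *+ 2 - phi (x n) @[n --> \oo] --> phi u *+ 2 - phi u.
    apply: cvgB => //; apply: cvgMn.
    by have := pxu; rewrite -(cvg_shiftS (phi \o x)).
  have -> : phi u = phi u *+ 2 - phi u by rewrite mulr2n addrK.
  rewrite -(cvg_lim _ c)//; apply: limr_le.
    by apply/cvg_ex; exists (phi u *+ 2 - phi u).
  near=> n; have := (fP (x n)).2 v (Strans _ _ _ (Su n) uv).
  by rewrite lerBlDl.
have : d * `|v - u| <= 0 by lra.
by rewrite pmulr_rle0// normr_le0 subr_eq0 => /eqP.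
Unshelve. all: by end_near. Qed.

Section RealInner.
Context (R : realType) (H : completeNormedModType R) (dot : {dot H for (@idfun R)}).
Hypothesis dot_norm : induces_norm dot.

Lemma dotC (u v : H) : dot u v = dot v u.
Proof. by rewrite hermC expr0 mul1r. Qed.

Lemma dotDl (u v w : H) : dot (u + v) w = dot u w + dot v w.
Proof. by rewrite linearDl. Qed.

Lemma dotZl a (u w : H) : dot (a *: u) w = a * dot u w.
Proof. by rewrite linearZl_LR. Qed.

Lemma dotNl (u w : H) : dot (- u) w = - dot u w.
Proof. by rewrite linearNl. Qed.

Lemma dotDr (u v w : H) : dot w (u + v) = dot w u + dot w v.
Proof. by rewrite !(dotC w) dotDl. Qed.

Lemma dotZr a (u w : H) : dot w (a *: u) = a * dot w u.
Proof. by rewrite !(dotC w) dotZl. Qed.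

Lemma dotNr (u w : H) : dot w (- u) = - dot w u.
Proof. by rewrite !(dotC w) dotNl. Qed.

Definition dotE := (dotDl, dotDr, dotNl, dotNr, dotZl, dotZr).

Lemma dotxx (u : H) : dot u u = `|u| ^+ 2.
Proof.
rewrite dot_norm sqr_sqrtr//; have [->|u0] := eqVneq u 0.
  by rewrite linear0l.
exact/ltW/neq0_dnorm_gt0.
Qed.

(** Cauchy-Schwarz, by expanding the square of [|v| u - |u| v]. *)
Lemma dot_le (u v : H) : dot u v <= `|u| * `|v|.
Proof.
have [->|u0] := eqVneq u 0; first by rewrite linear0l normr0 mul0r.
have [->|v0] := eqVneq v 0; first by rewrite dotC linear0l normr0 mulr0.
have : 0 <= dot (`|v| *: u - `|u| *: v) (`|v| *: u - `|u| *: v).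
  by rewrite dotxx sqr_ge0.
rewrite !dotE (dotC v u) !dotxx => h.
have uv0 : 0 < `|u| * `|v| by rewrite mulr_gt0 ?normr_gt0.
rewrite -(ler_pM2l uv0); move: h; lra.
Qed.


Lemma strongly_monotone_surj (G : H -> H) (c : R) :
  0 < c -> (forall u, differentiable G u) ->
  (forall u v, c * `|u - v| ^+ 2 <= dot (G u - G v) (u - v)) ->
  forall h, exists u, G u = h.
Proof.
move=> c0 Gdiff Gmon h.
have phic : continuous (fun v => `|G v - h|).
  move=> v; apply: cvg_norm; apply: cvgB; last exact: cvg_cst.
  exact: differentiable_continuous.
have d0 : 0 < c / 2 by lra.
(* Along w = h - G u, the distance |G - h| decreases at rate at least c |w|,
   which beats the slope c / 2 allowed at an Ekeland point. *)
have [u umin] := ekeland d0 (fun v => normr_ge0 (G v - h)) phic.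
exists u; apply: contrapT => /eqP; rewrite eq_sym -subr_eq0.
set w := h - G u => w0.
have n0 : 0 < `|w| by rewrite normr_gt0.
have /cvg_ex[/= l ql] := @diff_derivable _ _ _ _ _ w (Gdiff u).
(* [B] bounds the difference quotients of [G] at [u] along [w] for small [t]. *)
pose B := `|l| + 1; have B0 : 0 < B by rewrite ltr_wpDl.
have [|r /= r0 qB] := cvgr_norm_le l ql B; first by rewrite ltrDl.
near (0 : R)^'+ => t.
have t0 : 0 < t by [].
have tr : t < r by near: t; exact: nbhs_right_lt.
(* [tc] keeps the target [|w| (1 - t c / 2)] nonnegative, so that squares can be compared; [tB]
   makes the second-order term [|z|^2] at most half of the gain [2 (z, w) >= 2 c t |w|^2]. *)
have tc : t * (c / 2) < 1.
  rewrite -ltr_pdivlMr//; near: t; apply: nbhs_right_lt.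
  by rewrite divr_gt0.
have tB : t * B ^+ 2 < c * `|w| ^+ 2.
  rewrite -ltr_pdivlMr ?exprn_gt0//; near: t; apply: nbhs_right_lt.
  by rewrite divr_gt0 ?mulr_gt0 ?exprn_gt0.
have {}qB : `|G (t *: w + u) - G u| <= t * B.
  have := qB t; rewrite /= sub0r normrN gtr0_norm// => /(_ tr (lt0r_neq0 t0)).
  by rewrite normrZ normfV (gtr0_norm t0) ler_pdivrMl.
have := Gmon (t *: w + u) u.
have -> : t *: w + u - u = t *: w by rewrite addrK.
set z := G (t *: w + u) - G u in qB *.
rewrite normrZ gtr0_norm// dotZr => mon.
have {}mon : c * t * `|w| ^+ 2 <= dot z w.
  by rewrite -(ler_pM2l t0); move: mon; lra.
have tw0 : t *: w != 0 by rewrite scaler_eq0 negb_or (lt0r_neq0 t0).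
suff /umin/eqP : `|G (t *: w + u) - h| + c / 2 * `|t *: w + u - u| <= `|G u - h|.
  by rewrite -subr_eq0 addrK (negbTE tw0).
have -> : G (t *: w + u) - h = z - w by rewrite /z /w opprB addrA subrK.
rewrite addrK (distrC (G u)) -/w normrZ gtr0_norm//.
suff : `|z - w| <= `|w| * (1 - t * (c / 2)) by lra.
have r1 : 0 <= `|w| * (1 - t * (c / 2)) by rewrite mulr_ge0 ?subr_ge0 ?(ltW tc).
rewrite -(ler_pXn2r (n := 2)) ?nnegrE//.
rewrite -dotxx; clearbody z w; rewrite !dotE (dotC w z) !dotxx.
have z2 : `|z| ^+ 2 <= t * (c * `|w| ^+ 2).
  apply: (@le_trans _ _ ((t * B) ^+ 2)).
    by rewrite lerXn2r ?nnegrE// mulr_ge0// ltW.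
  by rewrite exprMn expr2 -mulrA ler_pM2l// ltW.
have : 0 <= (t * (c / 2) * `|w|) ^+ 2 by exact: sqr_ge0.
move: z2 mon; rewrite !expr2; lra.
Unshelve. all: by end_near. Qed.

(** Subtracting the equations, monotonicity reads [eta |y - x|^2 + (e - eta) (x, x - y) <= 0]. Were
    [(x, x - y)] positive, this would force [y = x], a contradiction; so [(x, x) <= (x, y)], and
    expanding [|y - x|^2] concludes. *)
Lemma regularized_dist (F : H -> H) (e eta : R) (h x y : H) :
  (forall u v, 0 <= dot (F u - F v) (u - v)) ->
  0 < eta <= e -> F x + e *: x = h -> F y + eta *: y = h ->
  `|y - x| ^+ 2 <= `|y| ^+ 2 - `|x| ^+ 2.
Proof.
move=> Fmon /andP[eta0 le_e] Fx Fy.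
have := Fmon x y; have -> : F x - F y = eta *: y - e *: x.
  rewrite -(addrK (e *: x) (F x)) Fx -(addrK (eta *: y) (F y)) Fy.
  by rewrite opprB addrC addrA subrK.
rewrite -!dotxx !dotE (dotC y x) => mon.
have := dotxx (y - x); rewrite !dotE (dotC y x) => DE.
have D0 := sqr_ge0 `|y - x|.
suff : dot x x <= dot x y by lra.
rewrite leNgt; apply/negP => ltP.
have : eta * `|y - x| ^+ 2 <= 0.
  have : 0 <= (e - eta) * (dot x x - dot x y) by rewrite mulr_ge0 ?subr_ge0 ?(ltW ltP).
  rewrite -DE; move: mon; lra.
rewrite pmulr_rle0// => D1; have /eqP : `|y - x| ^+ 2 = 0 by lra.
rewrite sqrf_eq0 normr_eq0 subr_eq0 => /eqP yx.
by rewrite yx ltxx in ltP.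
Qed.

End RealInner.

Theorem theorem1p1 (R : realType) (H : completeNormedModType R)
    (dot : {dot H for (@idfun R)}) (dot_norm : induces_norm dot)
    (F : H -> H) (F_diff : forall u : H, differentiable F u)
    (F_coercive : coercive dot F)
    (F_monotone : forall u v : H, 0 <= dot (F u - F v) (u - v)) :
  forall h : H, exists u : H, F u = h.
Proof.
move=> h.
pose e (n : nat) : R := n.+1%:R^-1.
have e0 n : 0 < e n by rewrite invr_gt0 ltr0n.
have /choice[x xE] n : exists x, F x + e n *: x = h.
  apply: (strongly_monotone_surj dot_norm (e0 n)) => [u|u v].
    by apply: differentiableD => //; apply: differentiableZ.
  rewrite opprD addrACA -scalerBr linearDl linearZl_LR /= dotxx//.
  by rewrite lerDr.
(* Any level above [|h|] works: [(x n, F (x n)) = (x n, h) - e n |x n|^2] is at most [|h| |x n|]. *)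
have [r [r0 rF]] := F_coercive (`|h| + 1) ltac:(by rewrite ltr_wpDl).
have xr n : `|x n| <= r.
  rewrite leNgt; apply/negP => rx; have := rF _ (ltW rx).
  have x0 : 0 < `|x n| by exact: lt_trans rx.
  rewrite ler_pdivlMr//; have -> : F (x n) = h - e n *: x n.
    by rewrite -(xE n) addrK.
  rewrite dotDr dotNr dotZr dotxx// => le1.
  have := dot_le dot_norm (x n) h.
  have : 0 <= e n * `|x n| ^+ 2 by rewrite mulr_ge0 ?sqr_ge0 ?ltW.
  lra.
have dist n m : (n <= m)%N -> `|x m - x n| ^+ 2 <= `|x m| ^+ 2 - `|x n| ^+ 2.
  move=> nm; apply: (@regularized_dist _ _ _ dot_norm F (e n) (e m) h) => //.
  by rewrite e0 /= lef_pV2 ?posrE ?ltr0n// ler_nat.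
have ndx : nondecreasing_seq (fun n => `|x n| ^+ 2).
  by move=> n m nm; rewrite -subr_ge0 (le_trans _ (dist _ _ nm)) ?sqr_ge0.
have /cvg_ex[/= u xu] : cvgn x.
  apply: (@cvgn_dist_expr _ _ _ (fun n => `|x n| ^+ 2) 1%N).
    apply: nondecreasing_is_cvgn => //; exists (r ^+ 2) => _ [n _ <-].
    by rewrite lerXn2r ?nnegrE// ltW.
  by move=> n m nm; rewrite ger0_norm ?subr_ge0 ?ndx// dist.
have Fxu : F (x n) @[n --> \oo] --> F u.
  by apply: continuous_cvg => //; exact: differentiable_continuous.
have Fxh : F (x n) @[n --> \oo] --> h.
  have -> : (fun n => F (x n)) = (fun n => h - e n *: x n).
    by apply/funext => n; rewrite -(xE n) addrK.
  suff : h - e n *: x n @[n --> \oo] --> h - 0 *: u by rewrite scale0r subr0.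
  apply: cvgB; first exact: cvg_cst.
  by apply: cvgZ => //; exact: cvg_harmonic.
by exists u; rewrite -(cvg_lim _ Fxu)// (cvg_lim _ Fxh).
Qed.
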